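(* There exist three pairwise non-equivalent even integral positive definite quadratic forms of discriminant $2$ and dimension $41$ which do not represent the number $2$.
   Context: An even integral quadratic form of dimension $n$ is a quadratic form $f$ on $\mathbb{Z}^n$ all of whose values are even integers; its associated bilinear form $(x,y)=\frac14\bigl(f(x+y)-f(x-y)\bigr)$ (so that $f(x)=(x,x)$) then takes integral values on $\mathbb{Z}^n$. The discriminant of $f$ is the determinant of the Gram matrix $\bigl((e_i,e_j)\bigr)_{i,j}$ in a $\mathbb{Z}$-basis $e_1,\dots,e_n$ of $\mathbb{Z}^n$. Two forms $f,g$ on $\mathbb{Z}^n$ are equivalent if $g=f\circ A$ for some $A\in \mathrm{GL}_n(\mathbb{Z})$. The form $f$ represents the number $m$ if there is $v\in\mathbb{Z}^n$ with $f(v)=m$. *)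

(* Defs.v *)
From mathcomp Require Import all_boot all_order all_algebra.
From mathcomp Require Import ring.

Set Implicit Arguments.
Unset Strict Implicit.
Unset Printing Implicit Defensive.

Import Order.TTheory GRing.Theory Num.Theory.
Local Open Scope ring_scope.

(* Forms on Z^n are functions on integer column vectors. The matrix c of
   coefficients need not be symmetric, so the mixed terms c_ij + c_ji may be
   odd: every integer-valued quadratic form on Z^n is of this shape. *)
Definition quadratic_form (n : nat) (f : 'cV[int]_n -> int) : Prop :=
  exists c : 'M[int]_n, forall v, f v = (v^T *m c *m v) 0 0.

Definition even_form (n : nat) (f : 'cV[int]_n -> int) : Prop :=
  quadratic_form f /\ forall v, (2 %| f v)%Z.

Definition positive_definite (n : nat) (f : 'cV[int]_n -> int) : Prop :=
  forall v, v != 0 -> 0 < f v.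

(* Computed in rat so that the division by 4 is exact. *)
Definition assoc_bilinear (n : nat) (f : 'cV[int]_n -> int)
    (x y : 'cV[int]_n) : rat :=
  (f (x + y) - f (x - y))%:~R / 4.

Definition gram (n : nat) (f : 'cV[int]_n -> int)
    (e : 'I_n -> 'cV[int]_n) : 'M[rat]_n :=
  \matrix_(i, j) assoc_bilinear f (e i) (e j).

(* Taken in the standard basis; gram_det_basis below shows that any other
   Z-basis (the columns of a unimodular matrix) gives the same value. *)
Definition discriminant (n : nat) (f : 'cV[int]_n -> int) : rat :=
  \det (gram f (fun i => delta_mx i 0)).

Definition equivalent (n : nat) (f g : 'cV[int]_n -> int) : Prop :=
  exists2 A : 'M[int]_n, A \in unitmx & forall v, g v = f (A *m v).

Definition represents (n : nat) (f : 'cV[int]_n -> int) (m : int) : Prop :=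
  exists v, f v = m.

Lemma assoc_bilinearE (n : nat) (f : 'cV[int]_n -> int) (c : 'M[int]_n) :
    (forall v, f v = (v^T *m c *m v) 0 0) ->
  forall x y,
    assoc_bilinear f x y = ((x^T *m (c + c^T) *m y) 0 0)%:~R / 2.
Proof.
move=> fE x y; rewrite /assoc_bilinear !fE.
have tr_c : (x^T *m c^T *m y) 0 0 = (y^T *m c *m x) 0 0.
  by rewrite -[in RHS](trmxK (y^T *m c *m x)) [RHS]mxE !trmx_mul trmxK mulmxA.
have -> : (x^T *m (c + c^T) *m y) 0 0
          = (x^T *m c *m y) 0 0 + (y^T *m c *m x) 0 0.
  by rewrite mulmxDr mulmxDl [LHS]mxE tr_c.
have mxD (P Q : 'M[int]_1) : (P + Q) 0 0 = P 0 0 + Q 0 0 by rewrite mxE.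
have mxN (P : 'M[int]_1) : (- P) 0 0 = - P 0 0 by rewrite mxE.
rewrite !(linearD, linearN) /= !(mulmxDl, mulmxDr, mulNmx, mulmxN) !(mxD, mxN).
by field.
Qed.

Lemma gram_det_basis (n : nat) (f : 'cV[int]_n -> int) (A : 'M[int]_n) :
  quadratic_form f -> A \in unitmx ->
  \det (gram f (fun i => col i A)) = discriminant f.
Proof.
move=> [c /assoc_bilinearE bE] uA; rewrite /discriminant.
pose G : 'M[rat]_n := 2^-1 *: map_mx intr (c + c^T).
pose Aq : 'M[rat]_n := map_mx intr A.
have gramE (B : 'M[int]_n) :
    gram f (fun i => col i B) = (map_mx intr B)^T *m G *m map_mx intr B.
  apply/matrixP=> i j; rewrite /G -scalemxAr -scalemxAl.
  rewrite map_trmx -!map_mxM !mxE bE mulrC; congr (_ * _%:~R).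
  by rewrite tr_col -row_mul colE mulmxA -colE -row_mul [LHS]mxE [LHS]mxE mxE.
have -> : gram f (fun i => delta_mx i 0) = gram f (fun i => col i 1%:M).
  by apply/matrixP=> i j; rewrite !mxE !colE !mul1mx.
have det2 : (\det Aq) ^+ 2 = 1.
  rewrite /Aq det_map_mx -rmorphXn /=; move: uA; rewrite unitmxE.
  by case/orP=> /eqP->.
rewrite !gramE map_mx1 trmx1 mul1mx mulmx1 !det_mulmx det_tr.
by rewrite mulrAC -expr2 det2 mul1r.
Qed.

(* Main.v *)
Require Import Defs.
From mathcomp Require Import all_boot all_order all_algebra.
From mathcomp Require Import ring lra zify.
Import Order.TTheory GRing.Theory Num.Theory.
Local Open Scope ring_scope.

(** Let C be a doubly even self-dual code of length 40 and minimum weight 8.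
    The vectors x in Z^41 whose first 40 coordinates reduce modulo 2 to a word
    of C and whose last coordinate is even form, for the norm |x|^2 / 2, an
    even lattice of discriminant 2, whose only roots are the 82 vectors
    supported on one coordinate.  Each of the three forms is a 5-neighbour of
    this lattice: the sublattice where the inner product with a glue vector h
    vanishes modulo 5, extended by h / 5.  Here h is twice (1, a), where
    a_k = 4 on 22 of the first 40 coordinates and a_k = 2 on the other 18.  The
    1 belongs to the last coordinate; it is called s, the others y, and points
    are scaled by 5, so that the norm is (s^2 + |y|^2) / 50 and s is even.

    No coordinate of h is divisible by 5, so the roots above do not survive.
    The other candidates are excluded by looking at coordinates modulo 10: if
    y_k = a_k s mod 5 with s prime to 5 and even, the smallest possible squares
    already add up to more than 100 ([no_roots]).  Both steps leave free which
    18 coordinates carry a 2.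

    The lattices are told apart by the number of vectors of norm 5/2 in the
    dual, that is, with s odd and s^2 + |y|^2 = 125.  Intrinsically, their
    doubles are the vectors w of norm 10 such that (w, x) is even for all x in
    the lattice.  The 18 coordinates are chosen as the complement of a pair
    inside a word c of weight 20.  Up to sign the vectors with s = 5 are then
    18 in number, there is one with s = 3, and those with s = 1 correspond to
    the zero word and the words of weight 8 of C which lie in c and contain the
    pair; this is forced by bounds on weights, C being doubly even with no word
    of weight 4 ([flip_odd_part], [trio_odd_part]).  The word c
    is the sum of three octads (words of weight 8) sharing one pair of
    coordinates and otherwise disjoint, and C has no further octads inside c.
    So the pair may lie in 3, 1 or 0 of these octads, which gives 46, 42 and
    40 vectors and hence three inequivalent lattices.

    On the matrix side, the sublattice s = 0 has the lower triangular basis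
    [basis_mx], from which the determinants follow; the determinant 25 of its
    Gram matrix is odd, and this identifies the kernel of the form modulo 2
    ([even_norm10P]). *)

Set Implicit Arguments.
Unset Strict Implicit.
Unset Printing Implicit Defensive.

(** * An extremal binary code of length 40 *)

Definition squares19 : seq nat := [:: 0; 1; 4; 5; 6; 7; 9; 11; 16; 17]%N.

(** Row i of a generator matrix (I | A) of the code, as a word on 40 positions:
    A is the bordered circulant of the squares modulo 19. *)
Definition gen (i k : nat) : bool :=
  (if k < 20 then k == i
   else let j := k - 20 in
     if (i == 0) || (j == 0) then i != j
     else (j + 19 - i) %% 19 \in squares19)%N.

Definition encode (s : seq nat) (k : nat) : bool := odd (count (gen^~ k) s).

Definition weight (e : nat -> bool) : nat := count e (iota 0 40).

Definition codeword (e : nat -> bool) : bool :=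
  all (fun k => e k == encode [seq i <- iota 0 20 | e i] k) (iota 0 40).

Lemma count_addb (T : Type) (a b : pred T) (l : seq T) :
  (count (fun k => a k (+) b k) l + 2 * count (fun k => a k && b k) l
   = count a l + count b l)%N.
Proof.
elim: l => //= k l IH.
by case: (a k); case: (b k) => /=; lia.
Qed.

Lemma encode_addb (e1 e2 : pred nat) l k :
  encode [seq i <- l | e1 i (+) e2 i] k
  = encode [seq i <- l | e1 i] k (+) encode [seq i <- l | e2 i] k.
Proof.
rewrite /encode !count_filter.
have := count_addb (predI (gen^~ k) e1) (predI (gen^~ k) e2) l.
move/(congr1 odd); rewrite oddD oddM andFb addbF oddD => <-.
congr (odd _); apply: eq_count => i /=.
by case: (gen i k).
Qed.

Lemma encode_cons i s k : encode (i :: s) k = gen i k (+) encode s k.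
Proof. by rewrite /encode /= oddD; case: (gen i k). Qed.

Lemma codewordP (e : nat -> bool) :
  reflect (forall k, (k < 40)%N -> e k = encode [seq i <- iota 0 20 | e i] k)
          (codeword e).
Proof.
apply: (iffP allP) => [H k lt_k|H k].
  by apply/eqP/H; rewrite mem_iota.
by rewrite mem_iota => /andP[_ /H/eqP].
Qed.

Lemma codeword_addb e1 e2 :
  codeword e1 -> codeword e2 -> codeword (fun k => e1 k (+) e2 k).
Proof.
move=> /codewordP h1 /codewordP h2; apply/codewordP => k lt_k.
by rewrite encode_addb -h1 // -h2.
Qed.

Lemma eq_codeword e1 e2 :
  (forall k, (k < 40)%N -> e1 k = e2 k) -> codeword e1 = codeword e2.
Proof.
move=> eq12; apply: eq_in_all => k; rewrite mem_iota => /andP[_ lt_k].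
rewrite eq12 //; congr (_ == encode _ _).
apply: eq_in_filter => i; rewrite mem_iota => /andP[_ lt_i].
by rewrite eq12 // (ltn_trans lt_i).
Qed.

Lemma eq_weight e1 e2 :
  (forall k, (k < 40)%N -> e1 k = e2 k) -> weight e1 = weight e2.
Proof.
by move=> eq12; apply: eq_in_count => k; rewrite mem_iota => /andP[_ /eq12].
Qed.

(** Doubly even generators that are pairwise orthogonal generate a doubly even
    code; this is the finite input to [encode_doubly_even]. *)
Lemma gen_self_orthogonal :
  all (fun i => (4 %| weight (gen i))%N
    && all (fun j => ~~ odd (weight (fun k => gen i k && gen j k))) (iota 0 20))
    (iota 0 20).
Proof. by vm_compute. Qed.

Lemma encode_doubly_even s :
  all (fun i => i < 20)%N s -> (4 %| weight (encode s))%N /\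
  forall j, (j < 20)%N -> ~~ odd (weight (fun k => gen j k && encode s k)).
Proof.
have genP i : (i < 20)%N -> (4 %| weight (gen i))%N /\
    forall j, (j < 20)%N -> ~~ odd (weight (fun k => gen i k && gen j k)).
  move=> lt_i; have /allP/(_ i) := gen_self_orthogonal.
  rewrite mem_iota => /(_ lt_i)/andP[-> /allP h]; split=> // j lt_j.
  by apply: h; rewrite mem_iota.
elim: s => [_|i s IH /= /andP[lt_i /IH[dvd4 even_s]]].
  have w0 (e : nat -> bool) : e =1 xpred0 -> weight e = 0%N.
    by move=> e0; rewrite /weight (eq_count e0) count_pred0.
  by split=> [|j _]; rewrite w0 // => k; rewrite /encode /= ?andbF.
have [gen4 gen_even] := genP _ lt_i.
split=> [|j lt_j].
  have := count_addb (gen i) (encode s) (iota 0 40).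
  rewrite -!/(weight _) (@eq_weight _ (encode (i :: s))) => [|k _].
    by have := even_s _ lt_i; move: gen4 dvd4; rewrite -!/(weight _); lia.
  by rewrite encode_cons.
have := count_addb (fun k => gen j k && gen i k) (fun k => gen j k && encode s k)
   (iota 0 40).
rewrite -!/(weight _) (@eq_weight _ (fun k => gen j k && encode (i :: s) k)).
  have := even_s _ lt_j; have [_ /(_ _ lt_i)] := genP _ lt_j.
  by rewrite -!/(weight _); lia.
by move=> k _; rewrite encode_cons; case: (gen j k).
Qed.

Lemma codeword_doubly_even e : codeword e -> (4 %| weight e)%N.
Proof.
move=> /codewordP codee; rewrite (eq_weight codee).
have lt20 : all (fun i => i < 20)%N [seq i <- iota 0 20 | e i].
  by apply/allP => i; rewrite mem_filter mem_iota => /andP[_ /andP[]].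
by have [] := encode_doubly_even lt20.
Qed.

(** Running through the sums of at most b of the generators, where acc is the
    check half of the current sum and w the number of generators used.  A word
    of weight 4 is a sum of at most 4 generators, since the information half of
    a generator is a unit vector; so about 6000 sums have to be inspected
    instead of 2^20. *)
Fixpoint no_weight4 (rows : seq bitseq) (b w : nat) (acc : bitseq) : bool :=
  if rows is r :: rows' then
    no_weight4 rows' b w acc &&
    (if b is b'.+1
     then no_weight4 rows' b' w.+1 [seq x.1 (+) x.2 | x <- zip r acc] else true)
  else (w + count id acc != 4)%N.

Lemma no_weight4P (J : seq nat) l b w f (e : pred nat) :
  no_weight4 [seq [seq gen i j | j <- J] | i <- l] b w
     [seq f j | j <- J] ->
  (count e l <= b)%N ->
  (w + count e l
   + count (fun j => f j (+) encode [seq i <- l | e i] j) J != 4)%N.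
Proof.
elim: l b w f => [|i l IH] b w f; rewrite /=.
  rewrite count_map addn0 => h _.
  set m' := count _ J; suff <- : count (preim f id) J = m' by [].
  by apply: eq_count => j /=; rewrite addbF.
case/andP=> h0 h1 /=; case: ifP => ei; last by rewrite add0n; apply: IH.
case: b h0 h1 => // b h0 h1 le_b.
have := IH b w.+1 (fun j => gen i j (+) f j) _ le_b.
rewrite zip_map -map_comp in h1 => /(_ h1).
set m := count _ J; set m' := count _ J.
have -> : m' = m; last by rewrite /= addnA addn1.
by apply: eq_count => j; rewrite encode_cons addbCA addbA.
Qed.

Lemma light_codewords :
  no_weight4 [seq [seq gen i j | j <- iota 20 20] | i <- iota 0 20] 4 0
    [seq false | j <- iota 20 20].
Proof. by vm_compute. Qed.

Lemma codeword_not_weight4 e : codeword e -> weight e != 4%N.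
Proof.
move=> /codewordP codee; apply/eqP => w4.
have w4' : (count e (iota 0 20) + count e (iota 20 20) = 4)%N.
  by rewrite -count_cat -iotaD.
have le4 : (count e (iota 0 20) <= 4)%N.
  exact: leq_trans (leq_addr _ _) (eq_leq w4').
have /eqP[] := @no_weight4P _ _ _ _ (fun=> false) e light_codewords le4.
rewrite add0n -[RHS]w4'; congr addn.
apply: eq_in_count => j; rewrite mem_iota => /andP[_ lt_j].
by rewrite addFb -codee.
Qed.

(** * Integer vectors read modulo the code *)

Definition oddz (x : int) : bool := odd `|x|.

Definition isum (g : nat -> int) : int := foldr (fun k s => g k + s) 0 (iota 0 40).

Lemma isumE (g : nat -> int) : \sum_(k < 40) g k = isum g.
Proof.
rewrite -(big_mkord xpredT g) /index_iota subn0 /isum.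
by elim: (iota 0 40) => [|k l IH]; rewrite ?big_nil // big_cons IH.
Qed.

Lemma weight_sum (e : nat -> bool) : (weight e)%:Z = \sum_(k < 40) (e k)%:Z.
Proof.
rewrite -(big_mkord xpredT (fun k => (e k)%:Z)) /index_iota subn0 /weight.
by elim: (iota 0 40) => [|k l IH]; rewrite ?big_nil // big_cons -IH.
Qed.

Lemma oddzE x : exists q, x = 2 * q + (oddz x)%:Z.
Proof.
exists (x %/ 2)%Z; rewrite /oddz; have := divz_eq x 2; move: (x %/ 2)%Z => q.
lia.
Qed.

Lemma oddzD x y : oddz (x + y) = oddz x (+) oddz y.
Proof. by rewrite /oddz; lia. Qed.

Lemma oddzM x y : oddz (x * y) = oddz x && oddz y.
Proof. by rewrite /oddz abszM oddM. Qed.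

Lemma oddz_sqr x : (4 %| x ^+ 2 - (oddz x)%:Z)%Z.
Proof.
have [q xE] := oddzE x; apply/dvdzP; exists (q ^+ 2 + q * (oddz x)%:Z).
by rewrite {1}xE; case: (oddz x) => /=; ring.
Qed.

(** A square is congruent modulo 4 to the parity of its root, so the norm is
    congruent to the weight of the odd positions. *)
Lemma codeword_sqr (z : nat -> int) :
  codeword (fun k => oddz (z k)) -> (4 %| \sum_(k < 40) z k ^+ 2)%Z.
Proof.
move=> /codeword_doubly_even codez.
have -> : \sum_(k < 40) z k ^+ 2
    = \sum_(k < 40) (z k ^+ 2 - (oddz (z k))%:Z)
      + (weight (fun k => oddz (z k)))%:Z.
  by rewrite weight_sum -big_split; apply: eq_bigr => k _; rewrite /= subrK.
apply: rpredD => //; apply: rpred_sum => k _.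
exact: oddz_sqr.
Qed.

Lemma codeword_dot (z z' : nat -> int) :
  codeword (fun k => oddz (z k)) -> codeword (fun k => oddz (z' k)) ->
  (2 %| \sum_(k < 40) z k * z' k)%Z.
Proof.
move=> code1 code2.
have code12 : codeword (fun k => oddz (z k + z' k)).
  by rewrite (eq_codeword (fun k _ => oddzD (z k) (z' k))); apply: codeword_addb.
have := codeword_sqr code12; have := codeword_sqr code1; have := codeword_sqr code2.
have -> : \sum_(k < 40) (z k + z' k) ^+ 2 = \sum_(k < 40) z k ^+ 2 +
    (\sum_(k < 40) z k * z' k) *+ 2 + \sum_(k < 40) z' k ^+ 2.
  by rewrite -sumrMnl -!big_split; apply: eq_bigr => k _; rewrite /= sqrrD.
by lia.
Qed.

(** A word of weight 20, the sum of the octads {5, 14, 18, 20, 21, 26, 28, 29},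
    {13, 16, 18, 20, 22, 23, 31, 35} and {11, 18, 19, 20, 27, 30, 32, 36}.  Any
    two of them meet exactly in {18, 20}. *)
Definition trio : seq nat :=
  [:: 5; 11; 13; 14; 16; 18; 19; 20; 21; 22; 23; 26; 27; 28; 29; 30; 31; 32; 35; 36]%N.

(** The three pairs lie in 3, 1 and 0 of the octads that make up [trio]. *)
Definition pairs : seq (nat * nat) := [:: (18, 20); (5, 14); (5, 13)]%N.

Definition short (pq : nat * nat) (k : nat) : bool :=
  [&& k \in trio, k != pq.1 & k != pq.2].

(** The first 40 coordinates a of the glue vector (1, a).  They are chosen even,
    so that adding multiples of a does not change parities, and of norm 424,
    which is -1 modulo 25, so that (1, a) is isotropic modulo 25. *)
Definition shift pq k : int := if short pq k then 2 else 4.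

(** The dual lattice, scaled by 5; the lattice itself is the part where s is even. *)
Definition dual_point pq (s : int) (y : nat -> int) : Prop :=
  [/\ codeword (fun k => oddz (y k)),
      forall k, (k < 40)%N -> (5 %| y k - shift pq k * s)%Z
    & (25 %| s + \sum_(k < 40) shift pq k * y k)%Z].

Lemma sqr_lower (n : nat) (x : int) : (n <= `|x|)%N -> (n * n)%:Z <= x ^+ 2.
Proof. move=> le_nx; nia. Qed.

Lemma sum_lower (g y : nat -> int) : (forall k, (k < 40)%N -> g k <= y k ^+ 2 :> int) ->
  isum g <= \sum_(k < 40) y k ^+ 2.
Proof. by move=> h; rewrite -isumE; apply: ler_sum => k _; apply: h. Qed.

Lemma mod5_cases (s : int) : exists t,
  [\/ s = 5 * t, s = 5 * t + 1, s = 5 * t - 1 | s = 5 * t + 2 \/ s = 5 * t - 2].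
Proof.
exists ((s + 2) %/ 5)%Z; move: ((s + 2) %/ 5)%Z (divz_eq (s + 2) 5)
  (ltz_pmod (s + 2) (isT : 0 < 5 :> int)) (modz_ge0 (s + 2) (isT : 5 != 0 :> int)).
move=> q; move: ((s + 2) %% 5)%Z => r sE r_lt r_ge.
have : r = 0 \/ r = 1 \/ r = 2 \/ r = 3 \/ r = 4 by lia.
case=> [|[|[|[|]]]] rE; [apply: Or44; right | apply: Or43 | apply: Or41
  | apply: Or42 | apply: Or44; left]; lia.
Qed.

(** A vector of norm 4 has at most 4 odd entries; the code has no word of weight
    4, so all entries are even. *)
Lemma norm4_vector (z : nat -> int) : codeword (fun k => oddz (z k)) ->
  \sum_(k < 40) z k ^+ 2 = 4 ->
  exists2 i, (i < 40)%N & exists2 u, (u = 2 \/ u = - 2) &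
    forall k, (k < 40)%N -> z k = if k == i then u else 0.
Proof.
move=> codez norm4.
have w_le4 : (weight (fun k => oddz (z k)) <= 4)%N.
  rewrite -lez_nat weight_sum -[X in _ <= X]/(4 : int) -[X in _ <= X]norm4.
  apply: ler_sum => k _; have [q {2}->] := oddzE (z k).
  by case: (oddz _) => /=; nia.
have w0 : weight (fun k => oddz (z k)) = 0%N.
  have := codeword_doubly_even codez; have /eqP := codeword_not_weight4 codez.
  by move: w_le4; case: (weight _) => [|[|[|[|[]]]]].
have evenz k : (k < 40)%N -> exists q, z k = 2 * q.
  move=> lt_k; have [q zE] := oddzE (z k); exists q; rewrite zE.
  suff -> : oddz (z k) = false by rewrite addr0.
  apply: contra_eqF w0 => odd_k; rewrite -lt0n -has_count.
  by apply/hasP; exists k; rewrite ?mem_iota.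
have [i zi] : exists i : 'I_40, z i != 0.
  apply/existsP; apply: contra_eqT norm4 => /existsPn h.
  by rewrite big1 // => k _; move: (h k); rewrite negbK => /eqP->.
have [q ziE] := evenz _ (ltn_ord i).
rewrite (bigD1 i) //= in norm4.
set S := \sum_(_ | _) _ in norm4.
have S_ge0 : 0 <= S by apply: sumr_ge0 => k _; apply: sqr_ge0.
have q1 : q = 1 \/ q = -1 by rewrite ziE in zi norm4; nia.
have S0 : S = 0 by case: q1 => qE; rewrite ziE qE in norm4; lia.
exists i => //; exists (z i); first by rewrite ziE; lia.
move=> k lt_k; case: eqP => [->//|/eqP neq_ki].
have := psumr_eq0P (fun (k : 'I_40) _ => sqr_ge0 (z k)) S0.
move=> /(_ (Ordinal lt_k) neq_ki) /eqP.
by rewrite sqrf_eq0 => /eqP.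
Qed.

(** * The neighbours contain no vector of norm 2 *)

(** The least sums of squares with s = 1, -1 and s = 2, -2 modulo 5, and the same
    sums corrected on the chosen pair as [flip_odd_part] and [trio_odd_part]
    require. *)
Lemma isum_classes pq : pq \in pairs ->
  [/\ isum (fun k => if short pq k then 4 else 1) = 94,
      isum (fun k => if short pq k then 1 else 4) = 106,
      isum (fun k => (if short pq k then 4 else 1)
                     - 5 * ((k \in trio) && ~~ short pq k)%:Z) = 84
    & isum (fun k => (if short pq k then 1 else 4)
                     - 5 * ((k \in trio) && ~~ short pq k)%:Z) = 96].
Proof. by rewrite !inE => /or3P[] /eqP->. Qed.

(** The residue 2 of the glue vector becomes 1 or 4 modulo 5 when s = 2 or 3
    modulo 5, so the two classes of coordinates exchange their least squares. *)
Lemma dual_sqr_lower pq s y k : dual_point pq s y -> (k < 40)%N ->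
  [/\ (exists t, s = 5 * t + 1 \/ s = 5 * t - 1) ->
         (if short pq k then 4 else 1) <= y k ^+ 2
    & (exists t, s = 5 * t + 2 \/ s = 5 * t - 2) ->
         (if short pq k then 1 else 4) <= y k ^+ 2].
Proof.
move=> [_ h _] /h /dvdzP[q yE]; rewrite /shift in yE.
split=> -[t sE]; case: ifP yE => _ yE.
- apply: (@sqr_lower 2); lia.
- apply: (@sqr_lower 1); lia.
- apply: (@sqr_lower 1); lia.
- apply: (@sqr_lower 2); lia.
Qed.

Lemma dual_mod5 pq t y : dual_point pq (5 * t) y ->
  exists z, [/\ forall k, (k < 40)%N -> y k = 5 * z k,
    codeword (fun k => oddz (z k)), (5 %| t + \sum_(k < 40) shift pq k * z k)%Z
    & \sum_(k < 40) y k ^+ 2 = 25 * \sum_(k < 40) z k ^+ 2].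
Proof.
move=> [codey y5 y25]; pose z k := (y k %/ 5)%Z.
have yE k : (k < 40)%N -> y k = 5 * z k.
  move=> /y5 /dvdzP[q yq]; rewrite /z mulrC divzK //.
  by apply/dvdzP; exists (q + shift pq k * t); rewrite mulrDl -yq; ring.
exists z; split=> //.
- rewrite -(@eq_codeword (fun k => oddz (y k))) // => k /yE ->.
  by rewrite oddzM.
- move: y25; rewrite (eq_bigr (fun k : 'I_40 => 5 * (shift pq k * z k))).
    rewrite -mulr_sumr -mulrDr => /dvdzP[q h]; apply/dvdzP; exists q.
    by apply: (mulfI (isT : 5 != 0 :> int)); rewrite h; ring.
  by move=> k _; rewrite yE //; ring.
- rewrite mulr_sumr; apply: eq_bigr => k _; rewrite yE //; ring.
Qed.

(** If 5 divides s, the point is 5 times a vector of norm 4, which is concentrated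
    in one coordinate ([norm4_vector] if s = 0), contrary to the divisibility by 25
    in [dual_point].  If not, s is at least 4 when it is 1 or -1 modulo 5 and at
    least 2 otherwise, and the least sums 94 + 16 and 106 + 4 exceed 100. *)
Lemma no_roots pq s y : pq \in pairs -> dual_point pq s y -> ~~ oddz s ->
  s ^+ 2 + \sum_(k < 40) y k ^+ 2 <> 100.
Proof.
move=> pqP dualy even_s norm.
have [sum1 sum2 _ _] := isum_classes pqP.
have [q sE] : exists q, s = 2 * q.
  by have [q sE] := oddzE s; exists q; rewrite sE (negPf even_s) addr0.
have [t] := mod5_cases s; case=> [s5|s1|s1|s2].
- rewrite s5 in dualy norm.
  have [z [_ codez sum5 normE]] := dual_mod5 dualy.
  have norm_z : t ^+ 2 + \sum_(k < 40) z k ^+ 2 = 4 by rewrite normE in norm; lia.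
  have S_ge0 : 0 <= \sum_(k < 40) z k ^+ 2.
    by apply: sumr_ge0 => k _; apply: sqr_ge0.
  (* s = 5 t and y = 5 z, with t even as s is *)
  have tE : t = 2 \/ t = -2 \/ t = 0 by move: norm_z S_ge0; nia.
  have {tE} [t2|t0] : (t = 2 \/ t = -2) \/ t = 0 by lia.
    have S0 : \sum_(k < 40) z k ^+ 2 = 0 by case: t2 norm_z => ->; lia.
    move: sum5; rewrite big1 => [|k _]; first by case: t2 => ->.
    have /eqP : z k ^+ 2 = 0.
      by apply: psumr_eq0P (fun (k : 'I_40) _ => sqr_ge0 (z k)) S0 _ _.
    by rewrite sqrf_eq0 => /eqP ->; rewrite mulr0.
  rewrite t0 expr0n add0r /= in norm_z sum5.
  have [i lt_i [u u2 zE]] := norm4_vector codez norm_z.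
  move: sum5; rewrite (bigD1 (Ordinal lt_i)) //= big1 => [|k neq_ki].
    by rewrite zE // eqxx /shift; case: ifP => _; case: u2 => ->.
  rewrite zE // ifN ?mulr0 //.
- have h k : (k < 40)%N -> (if short pq k then 4 else 1) <= y k ^+ 2.
    by move=> /(dual_sqr_lower dualy)[h _]; apply: h; exists t; lia.
  by have := sum_lower h; have := @sqr_lower 4 s; rewrite sum1; lia.
- have h k : (k < 40)%N -> (if short pq k then 4 else 1) <= y k ^+ 2.
    by move=> /(dual_sqr_lower dualy)[h _]; apply: h; exists t; lia.
  by have := sum_lower h; have := @sqr_lower 4 s; rewrite sum1; lia.
- have h k : (k < 40)%N -> (if short pq k then 1 else 4) <= y k ^+ 2.
    by move=> /(dual_sqr_lower dualy)[_ h]; apply: h; exists t; lia.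
  by have := sum_lower h; have := @sqr_lower 2 s; rewrite sum2; lia.
Qed.

(** The representative modulo 10 of least absolute value. *)
Definition residue10 (x : int) : int := ((x + 4) %% 10)%Z - 4.

Lemma residue10P x : exists m, x = 10 * m + residue10 x /\
   -4 <= residue10 x <= 5.
Proof.
exists ((x + 4) %/ 10)%Z; rewrite /residue10.
move: (divz_eq (x + 4) 10) (ltz_pmod (x + 4) (isT : 0 < 10 :> int))
  (modz_ge0 (x + 4) (isT : 10 != 0 :> int)); lia.
Qed.

Lemma residue10_sqr x : residue10 x ^+ 2 <= x ^+ 2.
Proof.
have [m [xE]] := residue10P x; move: (residue10 x) xE => c -> c_le.
have [m_gt0|m_lt0|->] := ltrgtP m 0; last by rewrite mulr0 add0r.
  have : 0 <= (- m) * (- (5 * m + c)) by apply: mulr_ge0; lia.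
  nia.
have : 0 <= m * (5 * m + c) by apply: mulr_ge0; lia.
nia.
Qed.

(** Multiples of 5 are excluded because 5 and -5 have the same square. *)
Lemma residue10_sqr_eq x :
  ~~ (5 %| x)%Z -> residue10 x ^+ 2 = x ^+ 2 -> x = residue10 x.
Proof.
move=> n5 eq2; have [m [xE r_le]] := residue10P x.
have m_eq : 20 * (m * (5 * m + residue10 x)) = 0.
  move: eq2; rewrite [in RHS]xE => /eqP; rewrite -subr_eq0 => /eqP h.
  by rewrite -[RHS]oppr0 -h; ring.
have : m * (5 * m + residue10 x) = 0 by lia.
move/eqP; rewrite mulf_eq0 => /orP[/eqP m0|/eqP c].
  by rewrite {1}xE m0 mulr0 add0r.
by case/dvdzP: n5; exists m; rewrite {1}xE; lia.
Qed.

(** * The vectors of norm 5/2 in the duals *)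

(** The shortest vector with given s and given odd positions o: modulo 5 and
    modulo 2 its entries are prescribed, hence modulo 10, the glue being even. *)
Definition reduced pq (s : int) (o : nat -> bool) (k : nat) : int :=
  residue10 (shift pq k * s + 5 * (o k)%:Z).

Lemma dual_residue10 pq s y k : dual_point pq s y -> (k < 40)%N ->
  residue10 (y k) = reduced pq s (fun k => oddz (y k)) k.
Proof.
move=> [_ h _] /h /dvdzP[q yE]; rewrite /reduced /residue10; congr (_ - 4).
have [r yr] := oddzE (y k).
have [q' qE] : exists q', q = 2 * q' + (oddz (y k))%:Z.
  by move: yE yr; rewrite /shift; case: ifP => _ yE yr;
    [exists (r - 2 * q - s) | exists (r - 2 * q - 2 * s)]; lia.
move: (oddz (y k)) qE => b qE.
have -> : y k + 4 = q' * 10 + (shift pq k * s + 5 * b%:Z + 4).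
  by rewrite -[y k](subrK (shift pq k * s)) yE qE; ring.
by rewrite modzMDl.
Qed.

(** The sum dominates the reduced one term by term, so equality of the sums is
    equality of the terms. *)
Lemma dual_reduced pq s y : dual_point pq s y -> ~~ (5 %| s)%Z ->
  \sum_(k < 40) y k ^+ 2
    <= isum (fun k => reduced pq s (fun k => oddz (y k)) k ^+ 2) ->
  forall k, (k < 40)%N -> y k = reduced pq s (fun k => oddz (y k)) k.
Proof.
move=> dualy n5 le_sum k lt_k; rewrite -(dual_residue10 dualy lt_k).
have gap_ge0 (i : 'I_40) : true -> 0 <= y i ^+ 2 - residue10 (y i) ^+ 2.
  by rewrite subr_ge0 residue10_sqr.
have gap0 : \sum_(i < 40) (y i ^+ 2 - residue10 (y i) ^+ 2) = 0.
  apply/eqP; rewrite eq_le sumr_ge0 // andbT big_split /= sumrN subr_le0.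
  apply: le_trans le_sum _; rewrite -isumE le_eqVlt; apply/orP; left; apply/eqP.
  by apply: eq_bigr => i _; rewrite (dual_residue10 dualy).
apply: residue10_sqr_eq.
  case: dualy => _ /(_ k lt_k) y5 _; apply: contra n5 => /dvdzP[q' yE].
  case/dvdzP: y5 => q; rewrite yE /shift; case: ifP => _ h; apply/dvdzP.
    by exists (3 * (q' - q) - s); lia.
  by exists (s - (q' - q)); lia.
have /eqP := @psumr_eq0P _ _ _ _ gap_ge0 gap0 (Ordinal lt_k) isT.
by rewrite subr_eq0 => /eqP.
Qed.

Fixpoint sublists (l : seq nat) : seq (seq nat) :=
  if l is x :: l' then sublists l' ++ [seq x :: t | t <- sublists l']
  else [:: [::]].

Lemma filter_sublists e l : filter e l \in sublists l.
Proof.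
elim: l => //= x l IH; rewrite mem_cat; case: ifP => _; last by rewrite IH.
by rewrite (mem_map (_ : injective (cons x))) ?IH ?orbT // => t t' [].
Qed.

(** For s = 1 the odd positions of a short vector turn out to be the complement
    of [trio] plus a word inside [trio]; t is the set of the generators that add up
    to that word, and has to be chosen among the seven with index in [trio]. *)
Definition flip (t : seq nat) (k : nat) : bool := (k \notin trio) (+) encode t k.

(** The dual vectors of norm 5/2 with s > 0.  For s = 1 the norm selects, among
    the 2^7 candidates of [flip], the zero word and the octads that lie in [trio]
    and contain the pair. *)
Definition half_vectors pq : seq (int * seq int) :=
  [seq (5, mkseq (fun k => if k == i then 10 else 0) 40)
     | i <- iota 0 40 & short pq i]
  ++ [seq (1, mkseq (reduced pq 1 (flip t)) 40)
       | t <- sublists [seq i <- iota 0 20 | i \in trio]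
       & isum (fun k => reduced pq 1 (flip t) k ^+ 2) == 124]
  ++ [:: (3, mkseq (reduced pq 3 (mem trio)) 40)].

Definition short_vectors pq : seq (int * seq int) :=
  half_vectors pq ++ [seq (- x.1, map -%R x.2) | x <- half_vectors pq].

Lemma short_vectors_size :
  map (fun pq => size (short_vectors pq)) pairs = [:: 46; 42; 40]%N.
Proof. by vm_compute. Qed.

Lemma short_vectors_uniq pq : pq \in pairs -> uniq (short_vectors pq).
Proof. by rewrite !inE => /or3P[] /eqP->; vm_compute. Qed.

Definition dualb pq (s : int) (l : seq int) : bool :=
  [&& size l == 40%N, oddz s, codeword (fun k => oddz l`_k),
      all (fun k => (5 %| l`_k - shift pq k * s)%Z) (iota 0 40),
      (25 %| s + isum (fun k => shift pq k * l`_k)%R)%Z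
    & s ^+ 2 + isum (fun k => l`_k ^+ 2) == 125].

Lemma short_vectors_dualb pq : pq \in pairs ->
  all (fun x => dualb pq x.1 x.2) (short_vectors pq).
Proof. by rewrite !inE => /or3P[] /eqP->; vm_compute. Qed.

Lemma short_vectors_dual pq s l : pq \in pairs -> (s, l) \in short_vectors pq ->
  [/\ size l = 40%N, oddz s, dual_point pq s (nth 0 l)
    & s ^+ 2 + \sum_(k < 40) l`_k ^+ 2 = 125].
Proof.
move=> pqP /(allP (short_vectors_dualb pqP)) /and5P[/eqP size_l odd_s codel].
move=> /allP l5; rewrite -!isumE => /andP[l25 /eqP norm]; split=> //; split=> //.
by move=> k lt_k; apply: l5; rewrite mem_iota.
Qed.

Lemma dualN pq s y : dual_point pq s y -> dual_point pq (- s) (fun k => - y k).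
Proof.
move=> [codey y5 y25]; split.
- rewrite (@eq_codeword _ (fun k => oddz (y k))) // => k _.
  by rewrite /oddz abszN.
- by move=> k /y5; rewrite mulrN -opprD rpredN.
- rewrite (eq_bigr (fun k : 'I_40 => - (shift pq k * y k))).
    by rewrite sumrN -opprD rpredN.
  by move=> k _; rewrite mulrN.
Qed.

Lemma trio_codeword : codeword (fun k => k \in trio) && codeword (fun k => k \notin trio).
Proof. by vm_compute. Qed.

Lemma sum_weight (b : int) (e : nat -> bool) :
  b * (weight e)%:Z = \sum_(k < 40) b * (e k)%:Z.
Proof. by rewrite weight_sum mulr_sumr. Qed.

(** Let e be the sum of the odd part of y and the complement of [trio].  Compared
    with the least sum 94, every position in e costs 5 more, and 15 more outside
    [trio]; only the chosen pair can save 10 in total.  Since 30 is left to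
    spend, e has weight at most 8, with equality only inside [trio]; and no other
    nonzero weight is possible. *)
Lemma flip_odd_part pq y : pq \in pairs -> dual_point pq 1 y ->
  1 + \sum_(k < 40) y k ^+ 2 = 125 ->
  forall k, (k < 40)%N -> k \notin trio -> oddz (y k).
Proof.
move=> pqP dualy norm k lt_k k_out.
have [codey y5 _] := dualy.
pose e k := (k \notin trio) (+) oddz (y k).
pose bad k := (k \notin trio) && ~~ oddz (y k).
have codee : codeword e.
  by apply: codeword_addb codey; case/andP: trio_codeword.
have lower i : (i < 40)%N ->
    (if short pq i then 4 else 1)
      - 5 * ((i \in trio) && ~~ short pq i)%:Z + (5 * (e i)%:Z + 10 * (bad i)%:Z)
    <= y i ^+ 2.
  move=> /y5 /dvdzP[q yE]; rewrite /e /bad; have [r yr] := oddzE (y i).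
  move: yE; rewrite /shift; case: ifP => [/and3P[-> _ _]|_] yE.
    case: (oddz _) yr => yr /=; [apply: (@sqr_lower 3) | apply: (@sqr_lower 2)]; lia.
  case: (oddz _) yr => yr; case: (i \in trio) => /=.
  - apply: le_trans (@sqr_lower 1 _ _) => //; lia.
  - apply: le_trans (@sqr_lower 1 _ _) => //; lia.
  - apply: le_trans (@sqr_lower 4 _ _) => //; lia.
  - apply: le_trans (@sqr_lower 4 _ _) => //; lia.
have := sum_lower lower.
rewrite -isumE big_split /= [X in _ + X]big_split /= -!sum_weight.
have [_ _ + _] := isum_classes pqP; rewrite -isumE => -> le_norm.
(* 84 + 5 weight e + 10 weight bad is at most 124 *)
have bad_le : (weight bad <= weight e)%N.
  by apply: sub_count => i /= /andP[i_out even_i]; rewrite /e i_out (negPf even_i).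
have bad0 : weight bad = 0%N.
  have := codeword_doubly_even codee; have /eqP := codeword_not_weight4 codee.
  move: (\sum_(_ < _) _) norm le_norm => S.
  move: (weight e) (weight bad) bad_le => we wb; lia.
apply: contra_eqT bad0 => even_k; rewrite -lt0n -has_count.
by apply/hasP; exists k; rewrite ?mem_iota // /bad k_out.
Qed.

(** As in [flip_odd_part], with the least sum 106 and only 10 left to spend: the
    odd part differs from [trio] in at most 4 positions, hence nowhere. *)
Lemma trio_odd_part pq y : pq \in pairs -> dual_point pq 3 y ->
  9 + \sum_(k < 40) y k ^+ 2 = 125 ->
  forall k, (k < 40)%N -> oddz (y k) = (k \in trio).
Proof.
move=> pqP dualy norm k lt_k.
have [codey y5 _] := dualy.
pose e k := (k \in trio) (+) oddz (y k).
have codee : codeword e.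
  by apply: codeword_addb codey; case/andP: trio_codeword.
have lower i : (i < 40)%N ->
    (if short pq i then 1 else 4)
      - 5 * ((i \in trio) && ~~ short pq i)%:Z + 5 * (e i)%:Z
    <= y i ^+ 2.
  move=> /y5 /dvdzP[q yE]; rewrite /e; have [r yr] := oddzE (y i).
  move: yE; rewrite /shift; case: ifP => [/and3P[-> _ _]|_] yE.
    case: (oddz _) yr => yr /=.
      apply: le_trans (@sqr_lower 1 _ _) => //; lia.
    apply: le_trans (@sqr_lower 4 _ _) => //; lia.
  case: (oddz _) yr => yr; case: (i \in trio) => /=;
    [apply: le_trans (@sqr_lower 3 _ _) => //; lia ..
    | apply: le_trans (@sqr_lower 2 _ _) => //; lia
    | apply: le_trans (@sqr_lower 2 _ _) => //; lia].
have := sum_lower lower; rewrite -isumE big_split /= -!sum_weight.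
have [_ _ _] := isum_classes pqP; rewrite -isumE => -> le_norm.
have e0 : weight e = 0%N.
  have := codeword_doubly_even codee; have /eqP := codeword_not_weight4 codee.
  move: (\sum_(_ < _) _) norm le_norm => S.
  move: (weight e) => we; lia.
have : ~~ e k.
  apply: contra_eqN e0 => ek; rewrite -lt0n -has_count.
  by apply/hasP; exists k; rewrite ?mem_iota.
by rewrite /e; case: (k \in trio); case: (oddz _).
Qed.

Lemma eq_mkseq_lt (T : Type) (f g : nat -> T) n :
  (forall k, (k < n)%N -> f k = g k) -> mkseq f n = mkseq g n.
Proof.
move=> eq_fg; apply/eq_in_map => k; rewrite mem_iota add0n => /andP[_].
exact: eq_fg.
Qed.

Lemma reduced_norm_one pq t : pq \in pairs ->
  t \in sublists [seq i <- iota 0 20 | i \in trio] ->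
  124 <= isum (fun k => reduced pq 1 (flip t) k ^+ 2).
Proof.
move=> pqP.
have /allP h : all (fun t => 124 <= isum (fun k => reduced pq 1 (flip t) k ^+ 2))
    (sublists [seq i <- iota 0 20 | i \in trio]).
  by move: pqP; rewrite !inE => /or3P[] /eqP->; vm_compute.
exact: h.
Qed.

Lemma reduced_norm_three pq : pq \in pairs ->
  isum (fun k => reduced pq 3 (mem trio) k ^+ 2) = 116.
Proof. by rewrite !inE => /or3P[] /eqP->; vm_compute. Qed.

Lemma eq_isum f g : (forall k, (k < 40)%N -> f k = g k) -> isum f = isum g.
Proof. by move=> eq_fg; rewrite -!isumE; apply: eq_bigr => k _; apply: eq_fg. Qed.

Lemma eq_reduced pq s o o' k : o k = o' k -> reduced pq s o k = reduced pq s o' k.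
Proof. by rewrite /reduced => ->. Qed.

Lemma half_vectors_five pq y : dual_point pq 5 y -> 25 + \sum_(k < 40) y k ^+ 2 = 125 ->
  (5, mkseq y 40) \in half_vectors pq.
Proof.
move=> dualy norm.
have [z [yE codez sum5 normE]] := dual_mod5 (dualy : dual_point pq (5 * 1) y).
have norm_z : \sum_(k < 40) z k ^+ 2 = 4 by rewrite normE in norm; lia.
have [i lt_i [u u2 zE]] := norm4_vector codez norm_z.
move: sum5; rewrite (bigD1 (Ordinal lt_i)) //= big1 => [|k neq_ki]; last first.
  by rewrite zE // ifN ?mulr0.
rewrite zE // eqxx addr0 /shift => sum5.
have [short_i {}u2] : short pq i /\ u = 2.
  by move: sum5; case: ifP => _; case: u2 => ->.
rewrite /half_vectors mem_cat; apply/orP; left; apply/mapP; exists i.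
  by rewrite mem_filter short_i mem_iota.
congr (_, _); apply: eq_mkseq_lt => k lt_k.
by rewrite yE // zE // u2; case: eqP.
Qed.

Lemma half_vectors_one pq y : pq \in pairs -> dual_point pq 1 y ->
  1 + \sum_(k < 40) y k ^+ 2 = 125 -> (1, mkseq y 40) \in half_vectors pq.
Proof.
move=> pqP dualy norm; have odd_out := flip_odd_part pqP dualy norm.
have [codey _ _] := dualy.
pose e k := (k \notin trio) (+) oddz (y k).
have codee : codeword e.
  by apply: codeword_addb codey; case/andP: trio_codeword.
pose t := [seq i <- [seq i <- iota 0 20 | i \in trio] | e i].
have oddE k : (k < 40)%N -> oddz (y k) = flip t k.
  move=> lt_k; rewrite /flip.
  have -> : t = [seq i <- iota 0 20 | e i].
    rewrite /t -filter_predI; apply: eq_in_filter => i; rewrite mem_iota.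
    move=> /andP[_ lt_i]; rewrite /= andb_idr // /e.
    by apply: contraLR => i_out; rewrite i_out odd_out // (ltn_trans lt_i).
  by move/codewordP: codee => /(_ k lt_k) <-; rewrite /e addbA addbb.
have tP : t \in sublists [seq i <- iota 0 20 | i \in trio].
  exact: filter_sublists.
have redE k : (k < 40)%N ->
    reduced pq 1 (fun k => oddz (y k)) k = reduced pq 1 (flip t) k.
  by move=> lt_k; apply: eq_reduced; apply: oddE.
have lower : isum (fun k => reduced pq 1 (flip t) k ^+ 2)
    <= \sum_(k < 40) y k ^+ 2.
  apply: sum_lower => k lt_k; rewrite -redE // -(dual_residue10 dualy lt_k).
  exact: residue10_sqr.
have norm_t := reduced_norm_one pqP tP.
have yE := @dual_reduced _ _ _ dualy isT.
rewrite (eq_isum (fun k lt_k => congr1 (fun x => x ^+ 2) (redE k lt_k))) in yE.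
rewrite /half_vectors mem_cat; apply/orP; right.
rewrite mem_cat; apply/orP; left; apply/mapP.
exists t; first by rewrite mem_filter tP andbT eq_le norm_t andbT; lia.
congr (_, _); apply: eq_mkseq_lt => k lt_k.
by rewrite yE ?redE //; lia.
Qed.

Lemma half_vectors_three pq y : pq \in pairs -> dual_point pq 3 y ->
  9 + \sum_(k < 40) y k ^+ 2 = 125 -> (3, mkseq y 40) \in half_vectors pq.
Proof.
move=> pqP dualy norm; have oddE := trio_odd_part pqP dualy norm.
have redE k : (k < 40)%N ->
    reduced pq 3 (fun k => oddz (y k)) k = reduced pq 3 (mem trio) k.
  by move=> lt_k; apply: eq_reduced; apply: oddE.
have yE := @dual_reduced _ _ _ dualy isT.
rewrite (eq_isum (fun k lt_k => congr1 (fun x => x ^+ 2) (redE k lt_k))) in yE.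
rewrite (reduced_norm_three pqP) in yE.
rewrite /half_vectors mem_cat; apply/orP; right.
rewrite mem_cat; apply/orP; right; rewrite mem_seq1; apply/eqP.
congr (_, _); apply: eq_mkseq_lt => k lt_k.
by rewrite yE ?redE //; lia.
Qed.

(** The least sums 94 and 106 leave at most 31 and 19 for s^2, and if
    s = 5 t, then t^2 plus a multiple of 4 is equal to 5. *)
Lemma half_vectors_complete pq s y : pq \in pairs -> dual_point pq s y ->
  oddz s -> 0 < s -> s ^+ 2 + \sum_(k < 40) y k ^+ 2 = 125 ->
  (s, mkseq y 40) \in half_vectors pq.
Proof.
move=> pqP dualy odd_s s_gt0 norm.
have [sum1 sum2 _ _] := isum_classes pqP.
have [q sE] : exists q, s = 2 * q + 1.
  by have [q sE] := oddzE s; exists q; rewrite sE odd_s.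
have lower1 : (exists t, s = 5 * t + 1 \/ s = 5 * t - 1) ->
    94 <= \sum_(k < 40) y k ^+ 2.
  move=> s1; rewrite -sum1; apply: sum_lower => k lt_k.
  by have [h _] := dual_sqr_lower dualy lt_k; apply: h.
have lower2 : (exists t, s = 5 * t + 2 \/ s = 5 * t - 2) ->
    106 <= \sum_(k < 40) y k ^+ 2.
  move=> s2; rewrite -sum2; apply: sum_lower => k lt_k.
  by have [_ h] := dual_sqr_lower dualy lt_k; apply: h.
have one : (exists t, s = 5 * t + 1 \/ s = 5 * t - 1) -> s = 1.
  move=> s1; have := lower1 s1; case: s1 => t s1 le_norm.
  have : s <= 5 by nia.
  lia.
have three : (exists t, s = 5 * t + 2 \/ s = 5 * t - 2) -> s = 3.
  move=> s2; have := lower2 s2; case: s2 => t s2 le_norm.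
  have : s <= 4 by nia.
  lia.
have [t [s5|s1|s1|s2]] := mod5_cases s.
- have s5' : s = 5.
    have dual5 := dualy; rewrite s5 in dual5.
    have [z [_ codez _ normE]] := dual_mod5 dual5.
    have := codeword_sqr codez.
    have : 0 <= \sum_(k < 40) z k ^+ 2 by apply: sumr_ge0 => k _; apply: sqr_ge0.
    rewrite normE s5 in norm; move: (\sum_(_ < _) _) norm => S norm S_ge0.
    move=> /dvdzP[r SE]; have : t <= 2 by nia.
    lia.
  by rewrite s5' in dualy norm *; apply: half_vectors_five.
- have s1' : s = 1 by apply: one; exists t; left.
  by rewrite s1' in dualy norm *; apply: half_vectors_one.
- have s1' : s = 1 by apply: one; exists t; right.
  by rewrite s1' in dualy norm *; apply: half_vectors_one.
- have s2' : s = 3 by apply: three; exists t.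
  by rewrite s2' in dualy norm *; apply: half_vectors_three.
Qed.

Lemma short_vectors_complete pq s y : pq \in pairs -> dual_point pq s y ->
  oddz s -> s ^+ 2 + \sum_(k < 40) y k ^+ 2 = 125 ->
  (s, mkseq y 40) \in short_vectors pq.
Proof.
move=> pqP dualy odd_s norm; rewrite mem_cat.
have [s_lt0|s_gt0|s0] := ltrgtP s 0; last by rewrite s0 in odd_s.
  apply/orP; right; apply/mapP; exists (- s, mkseq (fun k => - y k) 40).
    apply: half_vectors_complete (dualN dualy) _ _ _ => //.
    - by rewrite /oddz abszN.
    - by rewrite oppr_gt0.
    by rewrite sqrrN -norm; congr (_ + _); apply: eq_bigr => k _; rewrite sqrrN.
  congr (_, _); rewrite ?opprK // /mkseq -map_comp.
  by apply: eq_map => k; rewrite [RHS]opprK.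
by apply/orP; left; apply: half_vectors_complete.
Qed.

(** * A basis of the sublattice orthogonal to the glue vector modulo 5 *)

(** Half the glue vector: orthogonality to it modulo 5 is orthogonality to the
    glue vector. *)
Definition half_shift pq k : int := if short pq k then 1 else 2.

Lemma shiftE pq k : shift pq k = 2 * half_shift pq k.
Proof. by rewrite /shift /half_shift; case: ifP. Qed.

Definition entry (v : 'cV[int]_40) (k : nat) : int := v (inord k) 0.

Lemma entry_ord v (i : 'I_40) : entry v i = v i 0.
Proof. by rewrite /entry inord_val. Qed.

(** The generators of the code, followed by twice the unit vectors of the check
    positions except the last, whose column is left to [basis_mx]. *)
Definition gen_mx : 'M[int]_40 :=
  \matrix_(k, l) (if (l < 20)%N then (gen l k)%:Z
                  else if (l == k) && (l < 39)%N then 2 else 0).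

Definition half_col pq : 'cV[int]_40 := \col_k half_shift pq k.

(** A basis of the vectors z whose odd part is a codeword and for which the inner
    product d with [half_shift] is divisible by 5.  Each column of [gen_mx] is
    corrected in the last position by 2 d; as [half_shift] is 2 there, this turns
    d into 5 d.  The last column is 10 times the unit vector. *)
Definition basis_mx pq : 'M[int]_40 :=
  gen_mx + delta_mx ord_max 0
    *m (2 *: ((half_col pq)^T *m gen_mx) + 10 *: delta_mx 0 ord_max).

(** The entry of z in position k that the first 20 entries predict modulo 2. *)
Definition parity_sum (z : nat -> int) (k : nat) : int :=
  \sum_(l < 20) (gen l k)%:Z * z l.

Lemma oddz_parity_sum z k :
  oddz (parity_sum z k) = encode [seq i <- iota 0 20 | oddz (z i)] k.
Proof.
rewrite /parity_sum -(big_mkord xpredT (fun l => (gen l k)%:Z * z l)) /index_iota.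
rewrite subn0 /encode; elim: (iota 0 20) => [|i l IH]; first by rewrite big_nil.
rewrite big_cons oddzD oddzM IH /=; case: ifP => /= odd_i; last by rewrite andbF.
by rewrite oddD andbT; case: (gen i k).
Qed.

Lemma parity_sum_low z k : (k < 20)%N -> parity_sum z k = z k.
Proof.
move=> lt_k; rewrite /parity_sum (bigD1 (Ordinal lt_k)) //= big1 => [|l neq_lk].
  by rewrite /gen lt_k eqxx mul1r addr0.
rewrite /gen lt_k; case: eqP => [kl|_]; last by rewrite mul0r.
by case/eqP: neq_lk; apply: val_inj.
Qed.

Lemma gen_mx_entry v (k : 'I_40) :
  (gen_mx *m v) k 0 = parity_sum (entry v) k
    + (if (20 <= k < 39)%N then 2 * entry v k else 0).
Proof.
rewrite mxE /parity_sum.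
rewrite (eq_bigr (fun l : 'I_40 => (if (l < 20)%N then (gen l k)%:Z * entry v l else 0)
   + (if (l == k) && (20 <= k < 39)%N then 2 * entry v k else 0))); last first.
  move=> l _; rewrite !mxE -entry_ord; case: ltnP => lt_l; last first.
    have [lk|_] := eqVneq l k; last by rewrite mul0r addr0.
    by rewrite lk in lt_l *; rewrite lt_l add0r; case: ifP; rewrite ?mul0r.
  rewrite [X in _ + X]ifF ?addr0 //; apply: contraTF lt_l.
  by case/andP=> /eqP-> /andP[]; rewrite leqNgt.
rewrite big_split /=; congr (_ + _).
  rewrite -big_mkcond /=.
  by rewrite (big_ord_widen 40 (fun l => (gen l k)%:Z * entry v l)).
case: ifP => _; last by rewrite big1 // => l _; rewrite andbF.
by rewrite -big_mkcond (eq_bigl (pred1 k)) ?big_pred1_eq // => l; rewrite /= andbT.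
Qed.

Lemma half_last pq : pq \in pairs -> half_shift pq 39 = 2.
Proof. by rewrite !inE => /or3P[] /eqP->. Qed.

(** The parity checks of the code, on integer vectors. *)
Lemma codeword_oddzP (z : nat -> int) :
  codeword (fun k => oddz (z k)) <->
  forall k, (k < 40)%N -> (2 %| z k - parity_sum z k)%Z.
Proof.
have dvd2 x y : (2 %| x - y)%Z = (oddz x == oddz y) by rewrite /oddz; lia.
split=> [/codewordP h k lt_k|h].
  by rewrite dvd2 oddz_parity_sum h.
by apply/codewordP => k /h; rewrite dvd2 oddz_parity_sum => /eqP.
Qed.

Lemma eq_parity_sum z z' k : (forall l, (l < 20)%N -> z l = z' l) ->
  parity_sum z k = parity_sum z' k.
Proof. by move=> eq_z; apply: eq_bigr => l _; rewrite eq_z. Qed.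

Definition dot_half pq (v : 'cV[int]_40) : int := ((half_col pq)^T *m v) 0 0.

Lemma dot_halfE pq v : dot_half pq v = \sum_(k < 40) half_shift pq k * entry v k.
Proof. by rewrite /dot_half mxE; apply: eq_bigr => k _; rewrite !mxE entry_ord. Qed.

Lemma basis_mxE pq v : basis_mx pq *m v = gen_mx *m v
  + (2 * dot_half pq (gen_mx *m v) + 10 * v ord_max 0) *: delta_mx ord_max 0.
Proof.
rewrite /basis_mx mulmxDl; congr (_ + _).
rewrite -mulmxA mulmxDl -!scalemxAl -mulmxA.
have -> : (delta_mx 0 ord_max : 'rV[int]_40) *m v = (v ord_max 0)%:M.
  by rewrite -rowE [LHS]mx11_scalar mxE.
rewrite [(half_col pq)^T *m _]mx11_scalar -/(dot_half pq _).
by rewrite !scale_scalar_mx -raddfD /= mul_mx_scalar.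
Qed.

Lemma basis_mx_entry pq v k : (k < 40)%N ->
  entry (basis_mx pq *m v) k = parity_sum (entry v) k
    + (if (20 <= k < 39)%N then 2 * entry v k else 0)
    + (if k == 39 then 2 * dot_half pq (gen_mx *m v) + 10 * entry v 39 else 0).
Proof.
move=> lt_k; rewrite -[k]/(val (Ordinal lt_k)) entry_ord basis_mxE mxE gen_mx_entry.
congr (_ + _); rewrite !mxE andbT -val_eqE /= -(entry_ord v ord_max) /=.
by case: eqP; rewrite ?mulr1 ?mulr0.
Qed.

Lemma codeword_basis pq v :
  codeword (fun k => oddz (entry (basis_mx pq *m v) k)).
Proof.
apply/codeword_oddzP => k lt_k.
rewrite (@eq_parity_sum _ (entry v)) => [|l lt_l]; last first.
  rewrite basis_mx_entry ?(ltn_trans lt_l) // parity_sum_low // leqNgt lt_l addr0.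
  by rewrite ifN ?addr0 //; apply: contraTneq lt_l => ->.
rewrite basis_mx_entry //; case: ifP => _; case: ifP => _; apply/dvdzP.
- by exists (entry v k + dot_half pq (gen_mx *m v) + 5 * entry v 39); ring.
- by exists (entry v k); ring.
- by exists (dot_half pq (gen_mx *m v) + 5 * entry v 39); ring.
- by exists 0; ring.
Qed.

Lemma dot_half_basis pq v : pq \in pairs -> (5 %| dot_half pq (basis_mx pq *m v))%Z.
Proof.
move=> pqP; rewrite basis_mxE {1}/dot_half mulmxDr -scalemxAr.
have -> : (half_col pq)^T *m delta_mx ord_max 0 = 2%:M.
  by rewrite -colE [LHS]mx11_scalar !mxE half_last.
rewrite mxE -/(dot_half pq _) !mxE mulr1n; apply/dvdzP.
by exists (dot_half pq (gen_mx *m v) + 4 * v ord_max 0); ring.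
Qed.

Lemma basis_mx_onto pq (z : nat -> int) : pq \in pairs ->
  codeword (fun k => oddz (z k)) -> (5 %| \sum_(k < 40) half_shift pq k * z k)%Z ->
  exists v, forall k, (k < 40)%N -> entry (basis_mx pq *m v) k = z k.
Proof.
move=> pqP /codeword_oddzP even_z /dvdzP[m mE].
pose w k := ((z k - parity_sum z k) %/ 2)%Z.
have wE k : (k < 40)%N -> z k = parity_sum z k + 2 * w k.
  by move=> /even_z; rewrite mulrC /w => /divzK ->; rewrite addrC subrK.
(* with last coordinate 0 the columns of [gen_mx] miss z by 2 (w 39) in the
   last position, and their inner product d there is 5 m - 4 (w 39); the
   correction 2 d + 10 x then gives x = (w 39) - m *)
pose u k := if (k < 20)%N then z k else if (k < 39)%N then w k else w 39 - m.
pose v : 'cV[int]_40 := \col_k u k.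
have coordv k : (k < 40)%N -> entry v k = u k.
  by move=> lt_k; rewrite -[k]/(val (Ordinal lt_k)) entry_ord mxE.
have sumv k : parity_sum (entry v) k = parity_sum z k.
  apply: eq_parity_sum => l lt_l.
  by rewrite coordv ?(ltn_trans lt_l) // /u lt_l.
have dotE : dot_half pq (gen_mx *m v) = 5 * m - 4 * w 39.
  rewrite dot_halfE [5 * m]mulrC -mE.
  rewrite (bigD1 ord_max) // [in RHS](bigD1 ord_max) //=.
  have -> : entry (gen_mx *m v) 39 = parity_sum z 39.
    by rewrite (entry_ord _ ord_max : entry _ 39 = _) gen_mx_entry /= addr0 sumv.
  rewrite half_last // (wE 39) // (eq_bigr (fun k : 'I_40 => half_shift pq k * z k)).
    ring.
  move=> k neq_k.
  rewrite entry_ord gen_mx_entry sumv; congr (_ * _); rewrite wE //; congr (_ + _).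
  have lt_k : (k < 39)%N.
    have := ltn_ord k; rewrite ltnS leq_eqVlt => /orP[/eqP k39|//].
    by case/eqP: neq_k; apply: val_inj.
  rewrite lt_k andbT coordv // /u lt_k; case: (leqP 20 k) => // lt_k20.
  by apply: (addrI (parity_sum z k)); rewrite -wE // addr0 parity_sum_low.
exists v; move=> k lt_k; rewrite basis_mx_entry // sumv dotE coordv // /u.
have [lt_k20|le20k] /= := ltnP k 20.
  rewrite ifN ?addr0; last by apply: contraTneq lt_k20 => ->.
  by rewrite parity_sum_low.
have [lt_k39|le39k] /= := ltnP k 39.
  rewrite ifN ?addr0; last by apply: contraTneq lt_k39 => ->.
  by rewrite -wE.
have -> : k = 39%N by apply/eqP; rewrite eqn_leq le39k -ltnS lt_k.
by rewrite eqxx (wE 39) // coordv // /u /=; ring.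
Qed.

(** * Gram matrices and determinants *)

Lemma is_trig_basis pq : is_trig_mx (basis_mx pq).
Proof.
apply/is_trig_mxP => k l lt_kl.
have k_last : (k == ord_max) = false.
  by apply: contraTF lt_kl => /eqP->; rewrite -leqNgt -ltnS ltn_ord.
rewrite !mxE big_ord1 !mxE k_last mul0r addr0 /gen.
have -> : (l == k) = false by rewrite -val_eqE gtn_eqF.
case: ltnP => //= lt_l.
by rewrite (ltn_trans lt_kl lt_l) (ltn_eqF lt_kl).
Qed.

Lemma basis_diag pq (k : 'I_40) : basis_mx pq k k =
  if (k < 20)%N then 1 else if (k < 39)%N then 2 else 10.
Proof.
rewrite !mxE big_ord1 !mxE eqxx andbT.
have [->/=|neq_k] := eqVneq k ord_max.
  rewrite mulr1 mul1r add0r big1 ?mulr0 ?add0r // => i _.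
  by rewrite !mxE /= andbF mulr0.
have lt_k : (k < 39)%N.
  have := ltn_ord k; rewrite ltnS leq_eqVlt => /orP[/eqP k39|//].
  by case/eqP: neq_k; apply: val_inj.
by rewrite mul0r addr0 /gen eqxx lt_k; case: (k < 20)%N.
Qed.

Lemma det_basis pq : \det (basis_mx pq) = 2 ^+ 19 * 10.
Proof.
rewrite (det_trig (is_trig_basis pq)).
pose d k : int := if (k < 20)%N then 1 else if (k < 39)%N then 2 else 10.
rewrite (eq_bigr (fun k : 'I_40 => d k)) => [|k _]; last exact: basis_diag.
rewrite -(big_mkord xpredT d) (@big_cat_nat _ _ _ 20) //=.
rewrite (@big_cat_nat _ _ _ 39 20) //= big_nat1 big_nat_cond big1 => [|k]; last first.
  by rewrite andbT /d => /andP[_ ->].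
rewrite mul1r; congr (_ * _); rewrite (eq_big_nat _ _ (F2 := fun=> 2)) => [|k].
  by rewrite prodr_const_nat.
by rewrite /d => /andP[le_k ->]; rewrite ltnNge le_k.
Qed.

Definition beta pq : 'rV[int]_40 :=
  \row_j (((half_col pq)^T *m basis_mx pq) ord0 j %/ 5)%Z.

Definition zgram pq : 'M[int]_40 :=
  \matrix_(i, j) (((basis_mx pq)^T *m basis_mx pq) i j %/ 2)%Z.

Lemma betaE pq : pq \in pairs -> (half_col pq)^T *m basis_mx pq = 5 *: beta pq.
Proof.
move=> pqP; apply/rowP => j; rewrite [RHS]mxE [in RHS]mxE mulrC divzK //.
have := dot_half_basis (delta_mx j 0) pqP.
by rewrite /dot_half mulmxA -colE mxE.
Qed.

Lemma zgramE pq : (basis_mx pq)^T *m basis_mx pq = 2 *: zgram pq.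
Proof.
apply/matrixP => i j; rewrite [RHS]mxE [in RHS]mxE mulrC divzK //.
have := codeword_dot (codeword_basis pq (delta_mx i 0))
  (codeword_basis pq (delta_mx j 0)).
rewrite mxE; congr (_ %| _)%Z; apply: eq_bigr => k _.
by rewrite !entry_ord -!colE !mxE.
Qed.

Lemma half_norm pq : pq \in pairs -> (half_col pq)^T *m half_col pq = 106%:M.
Proof.
move=> pqP; rewrite [LHS]mx11_scalar; congr (_%:M); rewrite mxE.
rewrite (eq_bigr (fun k : 'I_40 => (fun k : nat => half_shift pq k ^+ 2) k)).
  rewrite (isumE (fun k : nat => half_shift pq k ^+ 2)).
  by move: pqP; rewrite !inE => /or3P[] /eqP->.
by move=> k _; rewrite !mxE expr2.
Qed.

(** The Gram matrix of the columns of [frame_mx], divided by 50; the entry 34 is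
    (2^2 + 4^2 * 106) / 50. *)
Definition form_mx pq : 'M[int]_(1 + 40) :=
  block_mx 34%:M (2 *: beta pq) (2 *: (beta pq)^T) (zgram pq).

(** The basis of the lattice in the orthogonal frame where the norm is
    (s^2 + |y|^2) / 50.  The first column is twice the glue vector (1, a), so
    dividing it by 2 gives the dual lattice. *)
Definition frame_mx pq : 'M[int]_(1 + 40) :=
  block_mx 2%:M 0 (4 *: half_col pq) (5 *: basis_mx pq).

Lemma frame_gram pq : pq \in pairs ->
  (frame_mx pq)^T *m frame_mx pq = 50 *: form_mx pq.
Proof.
move=> pqP; rewrite tr_block_mx mulmx_block scale_block_mx !trmx0 !linearZ /=.
rewrite !mul0mx !mulmx0 !add0r tr_scalar_mx.
rewrite -!scalemxAl zgramE (betaE pqP) half_norm //.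
have -> : (basis_mx pq)^T *m half_col pq = 5 *: (beta pq)^T.
  by rewrite -linearZ /= -betaE // trmx_mul trmxK.
rewrite -scalar_mxM !scale_scalar_mx -raddfD !scalerA.
by congr block_mx.
Qed.

Lemma zgram_sym pq : (zgram pq)^T = zgram pq.
Proof.
apply/matrixP => i j; rewrite !mxE; congr (_ %/ _)%Z.
by apply: eq_bigr => k _; rewrite !mxE mulrC.
Qed.

Lemma form_sym pq : (form_mx pq)^T = form_mx pq.
Proof. by rewrite tr_block_mx tr_scalar_mx !linearZ /= trmxK zgram_sym. Qed.

(** The literal 2, and in [det_form] also 5, becomes an indeterminate, so that
    [ring] compares exponents and never evaluates a power. *)
Lemma det_zgram pq : \det (zgram pq) = 25.
Proof.
have := congr1 determinant (zgramE pq).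
rewrite det_mulmx det_tr detZ det_basis.
move: (\det _) => d.
have -> : 10%:R = 2%:R * 5%:R :> int by [].
have two_neq0 : 2%:R ^+ 40 != 0%R :> int by rewrite expf_neq0.
move: two_neq0; move: (2%:R : int) => a a_neq0 eq_d.
apply: (mulfI a_neq0); rewrite -[LHS]eq_d (_ : 25%:R = 5%:R * 5%:R :> int) //; ring.
Qed.

Lemma det_form pq : pq \in pairs -> \det (form_mx pq) = 2.
Proof.
move=> pqP; have := congr1 determinant (frame_gram pqP).
rewrite det_mulmx det_tr det_lblock det_scalar1 !detZ det_basis.
move: (\det _) => d.
have -> : 10%:R = 2%:R * 5%:R :> int by [].
have -> : 50%:R = 2%:R * 5%:R * 5%:R :> int by [].
have neq0 : (2%:R * 5%:R * 5%:R) ^+ 41 != 0%R :> int by rewrite expf_neq0.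
move: neq0; move: (2%:R : int) (5%:R : int) => a b ab_neq0 eq_d.
apply: (mulfI ab_neq0); rewrite -eq_d; ring.
Qed.

(** * The three quadratic forms *)

Definition neighbor_form pq (v : 'cV[int]_(1 + 40)) : int := (v^T *m form_mx pq *m v) 0 0.

(** Half the coordinate s: every lattice point has s even. *)
Definition axis (v : 'cV[int]_(1 + 40)) : int := usubmx v 0 0.

(** The point a s + 5 z of the dual lattice, with a as in [shift] and z given by coordinates v in the
    basis; for even s it is a point of the lattice. *)
Definition lattice_point pq (s : int) (v : 'cV[int]_40) (k : nat) : int :=
  shift pq k * s + 5 * entry (basis_mx pq *m v) k.

Lemma shift_norm pq : pq \in pairs -> \sum_(k < 40) shift pq k ^+ 2 = 424.
Proof.
rewrite (isumE (fun k => shift pq k ^+ 2)).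
by rewrite !inE => /or3P[] /eqP->; vm_compute.
Qed.

(** The inner product with (1, a) is 425 s plus a multiple of 25, and 425 is
    divisible by 25. *)
Lemma lattice_point_dual pq s v : pq \in pairs -> dual_point pq s (lattice_point pq s v).
Proof.
move=> pqP; split.
- rewrite (@eq_codeword _ (fun k => oddz (entry (basis_mx pq *m v) k))).
    exact: codeword_basis.
  by move=> k _; rewrite /lattice_point oddzD !oddzM shiftE oddzM.
- move=> k _; apply/dvdzP; exists (entry (basis_mx pq *m v) k).
  by rewrite /lattice_point; ring.
- have /dvdzP[m mE] := dot_half_basis v pqP.
  rewrite dot_halfE in mE.
  rewrite (eq_bigr (fun k : 'I_40 => shift pq k ^+ 2 * s
     + 10 * (half_shift pq k * entry (basis_mx pq *m v) k))) => [|k _]; last first.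
    by rewrite /lattice_point shiftE; ring.
  rewrite big_split /= -mulr_suml -mulr_sumr mE.
  rewrite (shift_norm pqP).
  by apply/dvdzP; exists (17 * s + 2 * m); ring.
Qed.

Lemma frame_entry pq (v : 'cV[int]_(1 + 40)) : frame_mx pq *m v =
  col_mx (2 * axis v)%:M (\col_k lattice_point pq (2 * axis v) (dsubmx v) k).
Proof.
rewrite -{1}(vsubmxK v) mul_block_col mul0mx addr0; congr col_mx.
  by rewrite mul_scalar_mx [usubmx v]mx11_scalar scale_scalar_mx.
rewrite -!scalemxAl [usubmx v]mx11_scalar -/(axis v) mul_mx_scalar.
by apply/colP => k; rewrite !mxE /lattice_point entry_ord shiftE mxE; ring.
Qed.

Lemma form_norm pq v : pq \in pairs -> 50 * neighbor_form pq v =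
  (2 * axis v) ^+ 2 + \sum_(k < 40) lattice_point pq (2 * axis v) (dsubmx v) k ^+ 2.
Proof.
move=> pqP.
have -> : 50 * neighbor_form pq v
    = ((frame_mx pq *m v)^T *m (frame_mx pq *m v)) 0 0.
  rewrite trmx_mul mulmxA -[_ *m frame_mx pq]mulmxA frame_gram //.
  by rewrite -scalemxAr -scalemxAl mxE.
rewrite frame_entry tr_col_mx mul_row_col mxE; congr (_ + _).
  by rewrite tr_scalar_mx -scalar_mxM mxE eqxx mulr1n expr2.
by rewrite mxE; apply: eq_bigr => k _; rewrite !mxE expr2.
Qed.

Lemma lattice_point_inj pq s v w :
  (forall k, (k < 40)%N -> lattice_point pq s v k = lattice_point pq s w k) -> v = w.
Proof.
move=> eq_vw; have eqB : basis_mx pq *m v = basis_mx pq *m w.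
  apply/colP => k; have := eq_vw k (ltn_ord k); rewrite /lattice_point !entry_ord.
  by move/addrI/(mulfI (isT : 5 != 0 :> int)).
have : \det (basis_mx pq) *: v = \det (basis_mx pq) *: w.
  by rewrite -!mul_scalar_mx -mul_adj_mx -!mulmxA eqB.
move=> eq_d; apply/colP => k; have /colP/(_ k) := eq_d; rewrite !mxE.
by apply: mulfI; rewrite det_basis mulf_neq0 ?expf_neq0.
Qed.

Lemma form_even pq v : pq \in pairs -> (2 %| neighbor_form pq v)%Z.
Proof.
move=> pqP; have norm := form_norm v pqP.
have [codey _ _] := lattice_point_dual (2 * axis v) (dsubmx v) pqP.
have := codeword_sqr codey.
move: (\sum_(_ < _) _) norm => S norm /dvdzP[q SE].
apply/dvdzP; exists ((axis v) ^+ 2 + q - 12 * neighbor_form pq v).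
nia.
Qed.

(** * The even vectors of norm 10 *)

Lemma lattice_point0 pq s (k : nat) : lattice_point pq s 0 k = shift pq k * s.
Proof. by rewrite /lattice_point mulmx0 /entry mxE mulr0 addr0. Qed.

Lemma eq_axis_dsubmx (v w : 'cV[int]_(1 + 40)) :
  axis v = axis w -> dsubmx v = dsubmx w -> v = w.
Proof.
move=> eq_h eq_d; rewrite -(vsubmxK v) -(vsubmxK w) eq_d; congr (col_mx _ _).
by rewrite [LHS]mx11_scalar [RHS]mx11_scalar; congr (_%:M); apply: eq_h.
Qed.

Lemma form_pos pq (v : 'cV[int]_(1 + 40)) :
  pq \in pairs -> v != 0 -> 0 < neighbor_form pq v.
Proof.
move=> pqP; apply: contraNT; rewrite -leNgt => form_le0.
have norm := form_norm v pqP.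
set S := \sum_(_ < _) _ in norm.
have S_ge0 : 0 <= S by apply: sumr_ge0 => k _; apply: sqr_ge0.
have h0 : axis v = 0 by nia.
have S0 : S = 0 by rewrite h0 in norm; lia.
apply/eqP/eq_axis_dsubmx; first by rewrite h0 /axis !mxE.
rewrite (_ : dsubmx 0 = 0); last by apply/colP => k; rewrite !mxE.
apply: (@lattice_point_inj pq (2 * axis v)) => k lt_k.
rewrite lattice_point0 h0 !mulr0 -h0.
have /eqP : lattice_point pq (2 * axis v) (dsubmx v) (Ordinal lt_k) ^+ 2 = 0.
  pose y k := lattice_point pq (2 * axis v) (dsubmx v) k.
  by apply: (psumr_eq0P (fun (k : 'I_40) _ => sqr_ge0 (y k)) S0).
by rewrite sqrf_eq0 h0 mulr0 => /eqP.
Qed.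

Lemma form_discriminant pq : pq \in pairs -> discriminant (neighbor_form pq) = 2.
Proof.
move=> pqP; rewrite /discriminant.
have -> : gram (neighbor_form pq) (fun i => delta_mx i 0) = map_mx intr (form_mx pq).
  apply/matrixP => i j; rewrite !mxE (assoc_bilinearE (c := form_mx pq)) //.
  rewrite form_sym -mulr2n -mulmxA -scaler_nat -scalemxAl -scalemxAr.
  rewrite trmx_delta -colE -rowE !mxE rmorphM /= mulrC.
  by rewrite mulrA mulVf // mul1r.
by rewrite det_map_mx det_form.
Qed.

Lemma form_no_root pq v : pq \in pairs -> neighbor_form pq v <> 2.
Proof.
move=> pqP form2; have norm := form_norm v pqP; rewrite form2 in norm.
apply: (no_roots pqP (lattice_point_dual (2 * axis v) (dsubmx v) pqP)) (esym norm).
by rewrite /oddz abszM oddM.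
Qed.

(** The second condition says that (x, v) is even for all x; it is stated through
    values of the form, so that it is invariant under equivalence by definition. *)
Definition even_norm10 pq (v : 'cV[int]_(1 + 40)) : Prop :=
  neighbor_form pq v = 10 /\
  forall x, (8 %| neighbor_form pq (x + v) - neighbor_form pq (x - v))%Z.

Lemma form_polar pq x v :
  neighbor_form pq (x + v) - neighbor_form pq (x - v)
  = 4 * (x^T *m (form_mx pq *m v)) 0 0.
Proof.
have sym : (v^T *m form_mx pq *m x) 0 0 = (x^T *m form_mx pq *m v) 0 0.
  rewrite -[in LHS](trmxK (v^T *m _ *m x)) [LHS]mxE !trmx_mul trmxK form_sym.
  by rewrite mulmxA.
have mxD (P Q : 'M[int]_1) : (P + Q) 0 0 = P 0 0 + Q 0 0 by rewrite mxE.
have mxN (P : 'M[int]_1) : (- P) 0 0 = - P 0 0 by rewrite mxE.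
rewrite /neighbor_form mulmxA !(linearD, linearN) /= !(mulmxDl, mulmxDr, mulNmx, mulmxN).
by rewrite !(mxD, mxN) sym; ring.
Qed.

Lemma polar_even_mod2 pq v :
  (forall x, (8 %| neighbor_form pq (x + v) - neighbor_form pq (x - v))%Z)
  <-> exists u, form_mx pq *m v = 2 *: u.
Proof.
split=> [h|[u uE] x]; last first.
  rewrite form_polar uE -scalemxAr mxE mulrA.
  by apply/dvdzP; exists ((x^T *m u) 0 0); ring.
exists (\col_i ((form_mx pq *m v) i ord0 %/ 2)%Z).
apply/colP => i; rewrite [RHS]mxE [in RHS]mxE mulrC divzK //.
have := h (delta_mx i 0); rewrite form_polar trmx_delta -rowE mxE.
move=> /dvdzP[q qE]; apply/dvdzP; exists q.
apply: (mulfI (isT : 4%:R != 0%R :> int)); apply: etrans qE _; ring.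
Qed.

(** The form is even on the first basis vector against everything, and the rest
    of its Gram matrix has determinant 25, so it is invertible modulo 2: a vector
    in the kernel modulo 2 has even coordinates except the first one.  Thus it is
    twice a point of the dual lattice. *)
Lemma even_norm10P pq v : pq \in pairs ->
  even_norm10 pq v <->
  exists2 w, dsubmx v = 2 *: w
    & (axis v) ^+ 2 + \sum_(k < 40) lattice_point pq (axis v) w k ^+ 2 = 125.
Proof.
move=> pqP.
have normE w : dsubmx v = 2 *: w -> 50 * neighbor_form pq v =
    4 * ((axis v) ^+ 2 + \sum_(k < 40) lattice_point pq (axis v) w k ^+ 2).
  move=> wE; rewrite form_norm // mulrDr mulr_sumr; congr (_ + _); first by ring.
  apply: eq_bigr => k _; rewrite wE /lattice_point -scalemxAr !entry_ord mxE; ring.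
have actE : form_mx pq *m v = col_mx
    (34 *: usubmx v + 2 *: (beta pq *m dsubmx v))
    (2 *: ((beta pq)^T *m usubmx v) + zgram pq *m dsubmx v).
  by rewrite -{1}(vsubmxK v) mul_block_col mul_scalar_mx !scalemxAl.
split=> [[form10 /polar_even_mod2[u uE]]|[w wE norm]].
  have [w wE] : exists w, dsubmx v = 2 *: w.
    pose u' := dsubmx u - (beta pq)^T *m usubmx v.
    have zgram_even : zgram pq *m dsubmx v = 2 *: u'.
      move/(congr1 dsubmx): uE; rewrite actE col_mxKd linearZ /= => uE.
      by rewrite scalerBr -uE addrAC subrr add0r.
    (* the adjugate turns the congruence into 25 times the coordinates being
       even, and 1 = 25 - 2 * 12 *)
    exists (\adj (zgram pq) *m u' - 12 *: dsubmx v).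
    have := mul_adj_mx (zgram pq); rewrite det_zgram => adjE.
    have : 25 *: dsubmx v = 2 *: (\adj (zgram pq) *m u').
      by rewrite -mul_scalar_mx -adjE -mulmxA zgram_even scalemxAr.
    by rewrite scalerBr => <-; rewrite scalerA -scalerBl scale1r.
  by exists w => //; have := normE w wE; rewrite form10; lia.
split; first by have := normE w wE; rewrite norm; lia.
apply/polar_even_mod2; rewrite actE.
exists (col_mx (17 *: usubmx v + beta pq *m dsubmx v)
   ((beta pq)^T *m usubmx v + zgram pq *m w)).
by rewrite scale_col_mx !scalerDr scalerA wE -!scalemxAr.
Qed.

(** Half of a vector as in [even_norm10P], in the frame coordinates (s, y). *)
Definition half_point pq (v : 'cV[int]_(1 + 40)) : int * seq int :=
  (axis v, mkseq (fun k => lattice_point pq (2 * axis v) (dsubmx v) k %/ 2)%Z 40).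

Lemma lattice_point_double pq s w (k : nat) :
  (lattice_point pq (2 * s) (2 *: w) k %/ 2)%Z = lattice_point pq s w k.
Proof.
rewrite (_ : lattice_point _ _ _ k = lattice_point pq s w k * 2) ?mulzK //.
by rewrite /lattice_point /entry -scalemxAr mxE; ring.
Qed.

Lemma half_point_short pq v : pq \in pairs -> even_norm10 pq v ->
  half_point pq v \in short_vectors pq.
Proof.
move=> pqP /(even_norm10P _ pqP)[w wE norm].
rewrite /half_point wE (eq_mkseq (lattice_point_double pq (axis v) w)).
have dualw := lattice_point_dual (axis v) w pqP.
apply: short_vectors_complete => //.
have [/codeword_sqr] := dualw; move: norm; move: (\sum_(_ < _) _) => S norm.
have [q hE] := oddzE (axis v); case: (oddz _) hE => //= hE /dvdzP[r SE] _ _.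
by rewrite hE SE in norm; nia.
Qed.

Lemma half_point_inj pq v v' : pq \in pairs -> even_norm10 pq v ->
  even_norm10 pq v' -> half_point pq v = half_point pq v' -> v = v'.
Proof.
move=> pqP /(even_norm10P _ pqP)[w wE _] /(even_norm10P _ pqP)[w' wE' _].
rewrite /half_point wE wE' !(eq_mkseq (lattice_point_double pq _ _)) => eq_c.
have eq_h : axis v = axis v' := congr1 fst eq_c.
apply: eq_axis_dsubmx => //; rewrite wE wE'; congr (_ *: _).
apply: (@lattice_point_inj pq (axis v)) => k lt_k.
have := congr1 (fun c => nth 0 c.2 k) eq_c.
by rewrite /= !nth_mkseq // eq_h.
Qed.

Lemma half_point_onto pq x : pq \in pairs -> x \in short_vectors pq ->
  exists2 v, even_norm10 pq v & half_point pq v = x.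
Proof.
case: x => s l pqP /(short_vectors_dual pqP)[size_l _ [codel l5 l25] norm].
pose z k := ((l`_k - shift pq k * s) %/ 5)%Z.
have lE k : (k < 40)%N -> l`_k = shift pq k * s + 5 * z k.
  by move=> /l5 h; rewrite [5 * _]mulrC divzK // addrC subrK.
have codez : codeword (fun k => oddz (z k)).
  rewrite -(@eq_codeword (fun k => oddz l`_k)) // => k /lE ->.
  by rewrite oddzD !oddzM shiftE oddzM.
have z5 : (5 %| \sum_(k < 40) half_shift pq k * z k)%Z.
  have : (25 %| 10 * \sum_(k < 40) half_shift pq k * z k)%Z.
    have -> : 10 * \sum_(k < 40) half_shift pq k * z k
        = (s + \sum_(k < 40) shift pq k * l`_k) - 425 * s.
      rewrite [in RHS](eq_bigr (fun k : 'I_40 => shift pq k ^+ 2 * s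
        + 10 * (half_shift pq k * z k))) => [|k _]; last first.
        by rewrite lE // shiftE; ring.
      rewrite big_split /= -mulr_suml -mulr_sumr (shift_norm pqP); ring.
    by case/dvdzP: l25 => q ->; apply/dvdzP; exists (q - 17 * s); ring.
  move/dvdzP => [q qE]; apply/dvdzP.
  by exists (3 * q - \sum_(k < 40) half_shift pq k * z k); lia.
have [w wE] := basis_mx_onto pqP codez z5.
have pointE k : (k < 40)%N -> lattice_point pq s w k = l`_k.
  by move=> lt_k; rewrite /lattice_point wE // -lE.
pose v : 'cV[int]_(1 + 40) := col_mx s%:M (2 *: w).
have axisv : axis v = s by rewrite /axis /v col_mxKu mxE eqxx mulr1n.
have tailv : dsubmx v = 2 *: w by rewrite /v col_mxKd.
exists v.
  apply/(even_norm10P _ pqP); exists w => //; rewrite axisv -norm.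
  by congr (_ + _); apply: eq_bigr => k _; rewrite pointE.
rewrite /half_point tailv axisv (eq_mkseq (lattice_point_double pq s w)); congr (_, _).
by rewrite (eq_mkseq_lt pointE) -size_l mkseq_nth.
Qed.

(** * Non-equivalence *)

Lemma half_point_lift pq (l : seq (int * seq int)) : pq \in pairs ->
  {subset l <= short_vectors pq} ->
  exists2 vs : seq 'cV[int]_(1 + 40), map (half_point pq) vs = l
    & {in vs, forall v, even_norm10 pq v}.
Proof.
move=> pqP; elim: l => [|x l IH] sub_l; first by exists [::].
have [v v_min vE] := half_point_onto pqP (sub_l x (mem_head x l)).
have [vs <- vs_min] := IH (fun y yl => sub_l y (mem_behead (s := x :: l) yl)).
exists (v :: vs); first by rewrite /= vE.
by move=> w /[!inE] /orP[/eqP->|/vs_min].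
Qed.

(** An equivalence maps even vectors of norm 10 to such vectors injectively, and
    [half_point] puts these in bijection with the lists of short dual vectors. *)
Lemma equivalent_short_vectors pq rs : pq \in pairs -> rs \in pairs ->
  equivalent (neighbor_form pq) (neighbor_form rs) ->
  (size (short_vectors rs) <= size (short_vectors pq))%N.
Proof.
move=> pqP rsP [A unitA formE].
have [vs vsE vs_min] := half_point_lift rsP (fun x => id : x \in short_vectors rs -> _).
have A_min v : even_norm10 rs v -> even_norm10 pq (A *m v).
  case=> norm polar; split; first by rewrite -formE.
  move=> x; have := polar (invmx A *m x).
  by rewrite !formE mulmxDr mulmxBr mulKVmx.
have A_inj : injective (mulmx A : 'cV[int]_(1 + 40) -> _).
  by move=> v w /(congr1 (mulmx (invmx A))); rewrite !mulKmx.
rewrite -vsE size_map -(size_map (fun v => half_point pq (A *m v))).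
apply: uniq_leq_size.
  rewrite map_inj_in_uniq.
    by apply: (@map_uniq _ _ (half_point rs)); rewrite vsE short_vectors_uniq.
  move=> v w /vs_min/A_min v_min /vs_min/A_min w_min eq_vw.
  exact/A_inj/(half_point_inj pqP v_min w_min).
by move=> _ /mapP[v /vs_min/A_min v_min ->]; apply: half_point_short.
Qed.

Lemma equivalent_sym n (f g : 'cV[int]_n -> int) : equivalent f g -> equivalent g f.
Proof.
case=> A unitA gE; exists (invmx A); first by rewrite unitmx_inv.
by move=> v; rewrite gE mulKVmx.
Qed.

Theorem proposition3 :
  exists F : 'I_3 -> 'cV[int]_41 -> int,
    (forall i : 'I_3,
       [/\ even_form (F i), positive_definite (F i),
           discriminant (F i) = 2 & ~ represents (F i) 2]) /\
    (forall i j : 'I_3, i != j -> ~ equivalent (F i) (F j)).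
Proof.
pose pair_of (i : 'I_3) := nth (0, 0)%N pairs i.
have pair_ofP i : pair_of i \in pairs by apply: mem_nth.
exists (fun i => neighbor_form (pair_of i)); split=> [i|i j].
  split.
  - split; first by exists (form_mx (pair_of i)).
    by move=> v; apply: form_even.
  - by move=> v; apply: form_pos.
  - exact: form_discriminant.
  - by case=> v; apply: form_no_root.
apply: contra_neq_not => eq_ij; apply: val_inj => /=.
have eq_size : size (short_vectors (pair_of i)) = size (short_vectors (pair_of j)).
  apply/anti_leq/andP; split; apply: equivalent_short_vectors (pair_ofP _) (pair_ofP _) _.
    exact: equivalent_sym.
  exact: eq_ij.
have sizeE k : size (short_vectors (pair_of k)) = nth 0%N [:: 46; 42; 40]%N k.
  by rewrite -short_vectors_size (nth_map (0, 0)%N) // ltn_ord.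
rewrite !sizeE in eq_size.
by case: i j eq_size {eq_ij} => [[|[|[|i]]] //= lt_i] [[|[|[|j]]] //= lt_j].
Qed.
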